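(* If $k\ge3$ is odd, then $\mathcal{O}(\mathbb{C},k)=\emptyset$; that is, every overlap in $\mathbb{C}$ with respect to $\phi=\exp(2\pi\mathrm{i}/k)$ is trivial.
   Context: $\mathbf{k}=\{1,\dots,k-1\}$, $\mathbf{k}_0=\{0,\dots,k-1\}$. A quadruple $(i,j\mid s,t)\in\mathbf{k}^4$ with $i\ne s$ is an overlap if $\phi^\omega(\phi^j-1)(\phi^s-1)=(\phi^i-1)(\phi^t-1)$ for some $\omega\in\mathbf{k}_0$; it is trivial if one of $i\equiv\pm j$, $j\equiv\pm t$, $t\equiv\pm s$, $s\equiv\pm i\pmod k$ holds, nontrivial otherwise. $\mathcal{O}(\mathbb{C},k)$ is the set of nontrivial overlaps. *)

(* Defs.v *)
From mathcomp Require Import all_boot all_algebra.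
From mathcomp Require Import complex.
From mathcomp Require Import reals trigo.
Import GRing.Theory Num.Theory.

Set Implicit Arguments.
Unset Strict Implicit.
Unset Printing Implicit Defensive.

Local Open Scope ring_scope.
Local Open Scope complex_scope.

Definition phi (R : realType) (k : nat) : R[i] :=
  cos (2 * pi / k%:R) +i* sin (2 * pi / k%:R).

Definition in_kset (k a : nat) : bool := (0 < a)%N && (a < k)%N.

Definition pm_mod (k a b : nat) : bool :=
  (a == b %[mod k]) || ((a + b) == 0 %[mod k]).

Definition is_overlap (R : realType) (k i j s t : nat) : Prop :=
  [/\ in_kset k i, in_kset k j, in_kset k s, in_kset k t & i != s] /\
  exists w : nat, (w < k)%N /\
    (phi R k) ^+ w * ((phi R k) ^+ j - 1) * ((phi R k) ^+ s - 1)
    = ((phi R k) ^+ i - 1) * ((phi R k) ^+ t - 1).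

Definition trivial_quad (k i j s t : nat) : bool :=
  [|| pm_mod k i j, pm_mod k j t, pm_mod k t s | pm_mod k s i].

Definition in_O (R : realType) (k i j s t : nat) : Prop :=
  is_overlap R k i j s t /\ ~~ trivial_quad k i j s t.

(* Main.v *)
(* Write z = exp(2 pi i / k).  Since k is odd, z^2 is again a primitive k-th root
   of unity, so z -> z^2 extends to a Galois automorphism of Q(z).  Applying it to
   z^w (z^j - 1)(z^s - 1) = (z^i - 1)(z^t - 1) and dividing by the original
   relation gives z^w (z^j + 1)(z^s + 1) = (z^i + 1)(z^t + 1).  The half sum and
   half difference of the two relations are
     z^(w+j+s) + z^w = z^(i+t) + 1   and   z^(w+j) + z^(w+s) = z^i + z^t.
   The same automorphism shows that a sum of two k-th roots of unity determines
   them: A + B = C + D and A^2 + B^2 = C^2 + D^2 force {A, B} = {C, D}.  The four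
   resulting cases give j = i, j = t, j + t = 0 and i + j = 0 modulo k. *)

Require Import Defs.
From mathcomp Require Import all_boot all_algebra.
From mathcomp Require Import complex.
From mathcomp Require Import reals trigo.
From mathcomp Require Import all_order all_field.
From mathcomp Require Import ring lra.
Import Order.TTheory GRing.Theory Num.Theory.
Local Open Scope ring_scope.
Local Open Scope complex_scope.

Lemma map_poly_ratr_intr (F : numFieldType) (p : {poly int}) :
  map_poly ratr (map_poly intr p : {poly rat}) = map_poly intr p :> {poly F}.
Proof.
by rewrite -map_poly_comp; apply: eq_map_poly => m /=; rewrite ratr_int.
Qed.

(** A nonconstant rational divisor [q] has a root [x] in [algC]. This [x] is also a root of
    ['Phi_n], hence a primitive [n]-th root of unity, so its minimal polynomial over the rationals
    is ['Phi_n] itself, which therefore divides [q]. *)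
Lemma Cyclotomic_irreducible (n : nat) :
  (0 < n)%N -> irreducible_poly (map_poly intr 'Phi_n : {poly rat}).
Proof.
move=> n0; split.
  rewrite size_map_inj_poly ?size_Cyclotomic ?ltnS ?totient_gt0 //.
  exact: intr_inj.
move=> q sq dvq.
have /closed_rootP[x rx] : size (map_poly ratr q : {poly algC}) != 1%N.
  by rewrite size_map_poly.
have [z prz] := C_prim_root_exists n0.
have prx : n.-primitive_root x.
  rewrite -(root_cyclotomic prz) -(Cintr_Cyclotomic prz) -map_poly_ratr_intr.
  by move: rx; rewrite -!dvdp_XsubCl => /dvdp_trans; apply; rewrite dvdp_map.
rewrite /eqp dvq /=.
have [p [mp _] dv] := minCpolyP x.
rewrite dv in rx; suff -> : map_poly intr 'Phi_n = p by [].
apply: (map_inj_poly (fmorph_inj (ratr : rat -> algC)) (rmorph0 _)).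
by rewrite map_poly_ratr_intr (Cintr_Cyclotomic prx) -(minCpoly_cyclotomic prx).
Qed.

(** [z] is a root of ['X^n - 1], the product of the ['Phi_d] for [d] dividing [n]; a root of
    ['Phi_d] with [d] a proper divisor would satisfy [z ^+ d = 1], against primitivity. *)
Lemma root_Cyclotomic_prim (F : numFieldType) (n : nat) (z : F) :
  n.-primitive_root z -> root (map_poly intr 'Phi_n) z.
Proof.
move=> prz; have n0 := prim_order_gt0 prz.
have : root (map_poly intr (\prod_(d <- divisors n) 'Phi_d)) z.
  rewrite prod_Cyclotomic // rmorphB rmorph1 /= map_polyXn.
  by rewrite rootE !hornerE (prim_expr_order prz) subrr.
rewrite rmorph_prod /= -(big_map (fun d => map_poly intr 'Phi_d) predT id).
apply: contraLR => nr; rewrite root_bigmul; apply/allP => _ /mapP[d dn ->].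
move: dn; rewrite -dvdn_divisors // => dn.
have d0 := dvdn_gt0 n0 dn.
have [->//|dNn] := eqVneq d n; apply/negP => rd.
suff /eqP : z ^+ d = 1.
  rewrite -(prim_order_dvd prz) => nd; case/eqP: dNn.
  by apply/eqP; rewrite eqn_dvd dn nd.
have : root (map_poly intr ('X^d - 1 : {poly int})) z.
  rewrite -prod_Cyclotomic // (big_rem d) ?divisors_id //=.
  by rewrite rmorphM rootM rd.
by rewrite rmorphB rmorph1 /= map_polyXn rootE !hornerE subr_eq0 => /eqP.
Qed.

(** Plays the role of the Galois automorphism sending [z] to [w]: rational polynomial relations
    transfer because ['Phi_n] divides [p]. *)
Lemma root_ratr_prim (F : numFieldType) (n : nat) (z w : F) (p : {poly rat}) :
  n.-primitive_root z -> n.-primitive_root w ->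
  root (map_poly ratr p) z -> root (map_poly ratr p) w.
Proof.
move=> prz prw pz; have n0 := prim_order_gt0 prz.
have dvp : map_poly intr 'Phi_n %| p.
  (* Otherwise irreducibility makes ['Phi_n] and [p] coprime, also over [F], although [z] is a
     common root. *)
  rewrite -[_ %| _]negbK -irreducible_poly_coprime;
    last exact: Cyclotomic_irreducible.
  rewrite -(coprimep_map (ratr : {rmorphism rat -> F})).
  apply/negP => /coprimep_root/(_ _)/negP; apply; last exact: pz.
  by rewrite /= map_poly_ratr_intr root_Cyclotomic_prim.
have := root_Cyclotomic_prim _ _ _ prw.
rewrite -map_poly_ratr_intr -!dvdp_XsubCl => /dvdp_trans; apply.
by rewrite dvdp_map.
Qed.

Section OddOrder.

Variables (F : numFieldType) (k : nat) (z : F).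
Hypotheses (prz : k.-primitive_root z) (oddk : odd k).

Lemma root_ratr_prim_sqr (p : {poly rat}) :
  root (map_poly ratr p) z -> root (map_poly ratr p) (z ^+ 2).
Proof.
apply: (root_ratr_prim _ _ _ _ _ prz).
by rewrite prim_root_exp_coprime // coprime2n.
Qed.

Lemma prim_root_sum2 (a b c d : nat) :
  z ^+ a + z ^+ b = z ^+ c + z ^+ d ->
  z ^+ a = z ^+ c /\ z ^+ b = z ^+ d \/ z ^+ a = z ^+ d /\ z ^+ b = z ^+ c.
Proof.
move=> E.
have := root_ratr_prim_sqr ('X^a + 'X^b - 'X^c - 'X^d).
rewrite !(rmorphB, rmorphD) /= !map_polyXn !rootE !hornerE.
rewrite E addrAC addrK subrr => /(_ (eqxx _)) /eqP.
rewrite -!exprM ![(2 * _)%N]mulnC !exprM.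
move: E; move: (z ^+ a) (z ^+ b) (z ^+ c) (z ^+ d) => A B C D E E2.
(* Substituting [B = C + D - A] turns [A^2 + B^2 - C^2 - D^2] into [2 (A - C) (A - D)]. *)
have /eqP : (A - C) * (A - D) = 0.
  have DB : B = C + D - A by rewrite -E addrC addKr.
  apply: (mulfI (_ : 2%:R != 0)); first by rewrite pnatr_eq0.
  by rewrite mulr0 -E2 DB; ring.
rewrite mulf_eq0 !subr_eq0 => /orP[] /eqP AE; [left|right]; split => //.
  by apply: (addrI A); rewrite E AE.
by apply: (addrI A); rewrite E AE addrC.
Qed.

Lemma prim_root_overlap (w i j s t : nat) :
  z ^+ i != 1 -> z ^+ t != 1 ->
  z ^+ w * (z ^+ j - 1) * (z ^+ s - 1) = (z ^+ i - 1) * (z ^+ t - 1) ->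
  [|| z ^+ j == z ^+ i, z ^+ j == z ^+ t,
      z ^+ (j + t) == 1 | z ^+ (i + j) == 1].
Proof.
move=> ni nt E.
have := root_ratr_prim_sqr
  ('X^w * ('X^j - 1) * ('X^s - 1) - ('X^i - 1) * ('X^t - 1)).
rewrite !(rmorphB, rmorphM, rmorph1) /= !map_polyXn !rootE !hornerE E subrr.
move=> /(_ (eqxx _)); rewrite -!exprM ![(2 * _)%N]mulnC !exprM.
rewrite subr_eq0 => /eqP E2.
(* Each factor of [E2] splits as [x^2 - 1 = (x - 1) (x + 1)], and the factors of [E] cancel. *)
have E' : z ^+ w * (z ^+ j + 1) * (z ^+ s + 1) = (z ^+ i + 1) * (z ^+ t + 1).
  apply: (mulfI (_ : (z ^+ i - 1) * (z ^+ t - 1) != 0)).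
    by rewrite mulf_neq0 // subr_eq0.
  transitivity ((z ^+ i ^+ 2 - 1) * (z ^+ t ^+ 2 - 1)); last by ring.
  by rewrite -E2 -E; ring.
have two0 : 2%:R != 0 :> F by rewrite pnatr_eq0.
(* The constant 1 is written [z ^+ 0] to fit [prim_root_sum2]. *)
have S1 : z ^+ (w + j + s) + z ^+ w = z ^+ (i + t) + z ^+ 0.
  apply: (mulfI two0); rewrite !exprD expr0.
  transitivity (z ^+ w * (z ^+ j + 1) * (z ^+ s + 1)
                + z ^+ w * (z ^+ j - 1) * (z ^+ s - 1)); first by ring.
  by rewrite E E'; ring.
have S2 : z ^+ (w + j) + z ^+ (w + s) = z ^+ i + z ^+ t.
  apply: (mulfI two0); rewrite !exprD.
  transitivity (z ^+ w * (z ^+ j + 1) * (z ^+ s + 1)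
                - z ^+ w * (z ^+ j - 1) * (z ^+ s - 1)); first by ring.
  by rewrite E E'; ring.
have z0 m : z ^+ m != 0.
  apply/expf_neq0/eqP => z0; have /eqP := prim_expr_order prz.
  by rewrite z0 expr0n gtn_eqF ?(prim_order_gt0 prz) // eq_sym oner_eq0.
(* [S1] gives [z^w = 1] or [z^w = z^(i+t)]; [S2] gives [z^(w+j) = z^i] or [z^(w+j) = z^t].
   Eliminating [z^w] leaves one alternative in each case. *)
case: (prim_root_sum2 _ _ _ _ S1) => [[_ w1]|[_ wit]];
  case: (prim_root_sum2 _ _ _ _ S2) => [[wj _]|[wj _]]; move: wj; rewrite exprD.
- by rewrite w1 mul1r => /eqP ->.
- by rewrite w1 mul1r => /eqP ->; rewrite /= orbT.
- rewrite wit exprD -mulrA -[RHS]mulr1 => /(mulfI (z0 _)).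
  by rewrite mulrC -exprD => /eqP ->; rewrite /= !orbT.
- rewrite wit exprD mulrAC -[RHS]mul1r => /(mulIf (z0 _)).
  by rewrite -exprD => /eqP ->; rewrite /= !orbT.
Qed.

End OddOrder.

Lemma phi_expr (R : realType) (k n : nat) :
  phi R k ^+ n = cos (n%:R * (2 * pi / k%:R)) +i* sin (n%:R * (2 * pi / k%:R)).
Proof.
elim: n => [|n IH]; first by rewrite expr0 mul0r cos0 sin0.
rewrite exprSr IH /phi; set x := 2 * pi / k%:R : R.
have -> : n.+1%:R * x = n%:R * x + x by rewrite -addn1 natrD mulrDl mul1r.
rewrite cosD sinD.
by apply/eqP; rewrite eq_complex /= [X in _ && (X == _)]addrC !eqxx.
Qed.

Lemma phi_prim_root (R : realType) (k : nat) :
  (0 < k)%N -> k.-primitive_root (phi R k).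
Proof.
move=> k0; have k0R : k%:R != 0 :> R by rewrite pnatr_eq0 -lt0n.
apply/andP; split=> //; apply/forallP => -[m /= mk].
rewrite unity_rootE phi_expr.
have [->|mNk] := eqVneq m.+1 k.
  by rewrite mulrC divfK // mulr_natl cos2pi sin2pi !eqxx.
have {mNk}mk : (m.+1 < k)%N by rewrite ltn_neqAle mNk.
rewrite eqbF_neg eq_complex /= negb_and; apply/orP; left.
(* Half the angle: [x] lies strictly between 0 and [pi], so [cos (2x) = 1 - 2 sin(x)^2 < 1]. *)
set x := m.+1%:R * (pi / k%:R) : R.
have -> : m.+1%:R * (2 * pi / k%:R) = x *+ 2 by rewrite /x; ring.
have : 0 < sin x.
  apply: sin_gt0_pi; rewrite mulr_gt0 ?divr_gt0 ?ltr0n ?pi_gt0 //=.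
  rewrite /x mulrCA -ltr_pdivlMl ?pi_gt0 // mulVf ?gt_eqF ?pi_gt0 //.
  by rewrite ltr_pdivrMr ?ltr0n // mul1r ltr_nat.
rewrite cos_mulr2n cos2sin2 => sx.
by rewrite lt_eqF //; have := exprn_gt0 2 sx; lra.
Qed.

Theorem theorem27 (R : realType) (k : nat) :
  (3 <= k)%N -> odd k ->
  forall i j s t : nat, ~ in_O R k i j s t.
Proof.
move=> k3 oddk i j s t [[[ki kj ks kt _] [w [_ E]]] /negP]; apply.
have prz : k.-primitive_root (phi R k).
  by apply: phi_prim_root; apply: leq_trans k3.
have neq1 a : in_kset k a -> phi R k ^+ a != 1.
  by case/andP=> a0 ak; rewrite -(prim_order_dvd prz) gtnNdvd.
have := prim_root_overlap _ _ _ prz oddk _ _ _ _ _ (neq1 _ ki) (neq1 _ kt) E.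
(* With 1 as a zeroth power, equalities of powers become congruences of exponents modulo [k]. *)
rewrite -(expr0 (phi R k)) !(eq_prim_root_expr prz) /trivial_quad /pm_mod.
by case/or4P => [/eqP->|->|->|->]; rewrite ?eqxx ?orbT.
Qed.
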